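(* Let $n=2m$ with $m\ge 1$ and let $\mathcal{N}=\{1,\dots,n\}$. The graded ternary commutators of the generators $\gamma_I$, $I\subseteq\mathcal{N}$, of the $3$-Lie superalgebra $\mathfrak{C}^{(3)}_n$ are given, up to a permutation of arguments by graded skew-symmetry, by $$[\gamma_I,\gamma_J,\gamma_K]=\begin{cases} (2i)^m f(I,J)\,\gamma_{I\Delta J} & \text{if } I\neq\mathcal{N},\ J\neq\mathcal{N},\ K=\mathcal{N},\\ 0 & \text{in all other cases.}\end{cases}$$ That is: the first line holds whenever $K=\mathcal{N}$ and $I,J\ne\mathcal{N}$; the commutator vanishes whenever the number of sets among $I,J,K$ equal to $\mathcal{N}$ is not exactly one; and the cases where exactly one of $I,J$ equals $\mathcal{N}$ and $K\neq\mathcal{N}$ are determined from the first line by graded skew-symmetry.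
   Context: Here $i$ in $(2i)^m$ is the imaginary unit. The Clifford algebra $C_n$ is the unital associative algebra over $\mathbb{C}$ generated by $\gamma_1,\dots,\gamma_n$ with $\gamma_i\gamma_j+\gamma_j\gamma_i=2\delta_{ij}e$, $e$ the unit. For $I=\{i_1<\dots<i_k\}\subseteq\mathcal{N}$ put $\gamma_I=\gamma_{i_1}\cdots\gamma_{i_k}$, $\gamma_\emptyset=e$; the $\gamma_I$ form a basis of $C_n$. Let $|I|$ be the number of elements of $I$; $\gamma_I$ has degree $|I| \bmod 2$. Let $I\Delta J$ be the symmetric difference, $\sigma(I,J)=\sum_{j\in J}\sigma(I,j)$ where $\sigma(I,j)$ is the number of elements of $I$ greater than $j$, and $$f(I,J)=(-1)^{\sigma(I,J)}\bigl(1-(-1)^{|I\cap J|}\bigr).$$ The graded commutator $[x,y]=xy-(-1)^{|x||y|}yx$ makes $C_n$ a Lie superalgebra $\mathfrak{C}_n$, with $[\gamma_I,\gamma_J]=f(I,J)\gamma_{I\Delta J}$. For $n=2m$ the supertrace coming from the spinor supermodule of $C_n$ is the linear map $\mathrm{Str}:C_n\to\mathbb{C}$ with $\mathrm{Str}(\gamma_I)=0$ if $I\neq\mathcal{N}$ and $\mathrm{Str}(\gamma_{\mathcal{N}})=(2i)^m$. The $3$-Lie superalgebra $\mathfrak{C}^{(3)}_n$ is the super vector space $C_n$ with the trilinear graded skew-symmetric bracket determined on the basis by $$[\gamma_I,\gamma_J,\gamma_K]=\mathrm{Str}(\gamma_I)[\gamma_J,\gamma_K]-(-1)^{|I||J|}\mathrm{Str}(\gamma_J)[\gamma_I,\gamma_K]+(-1)^{|K|(|I|+|J|)}\mathrm{Str}(\gamma_K)[\gamma_I,\gamma_J].$$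 Graded skew-symmetry means $[x_1,x_2,x_3] = -(-1)^{|x_1||x_2|}[x_2,x_1,x_3]=-(-1)^{|x_2||x_3|}[x_1,x_3,x_2]$ for homogeneous elements. *)

(* Defs.v *)
From HB Require Import structures.
From mathcomp Require Import all_boot all_order all_algebra.
From mathcomp Require classical_sets.
From mathcomp Require Import reals.
From mathcomp Require Import complex.

Set Implicit Arguments.
Unset Strict Implicit.
Unset Printing Implicit Defensive.

Import Order.TTheory GRing.Theory Num.Theory.
Local Open Scope ring_scope.

(* The index set {1, ..., n} is 'I_n = {0, ..., n-1}; only the order of the
   indices matters. *)

Definition symdiff (n : nat) (I J : {set 'I_n}) : {set 'I_n} :=
  (I :\: J) :|: (J :\: I).

Definition sigma1 (n : nat) (I : {set 'I_n}) (j : 'I_n) : nat :=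
  #|[set i in I | (j < i)%N]|.

Definition sigma (n : nat) (I J : {set 'I_n}) : nat :=
  (\sum_(j in J) sigma1 I j)%N.

Definition fsign (R : realType) (n : nat) (I J : {set 'I_n}) : R[i] :=
  (-1) ^+ sigma I J * (1 - (-1) ^+ #|I :&: J|).

Section Clifford.
Variables (R : realType) (n : nat).

Definition clifford_relations (B : algType R[i]) (h : 'I_n -> B) : Prop :=
  forall i j : 'I_n, h i * h j + h j * h i = (2%:R * (i == j)%:R)%:A.

(* A is presented, as a unital associative algebra, by the generators g and
   the Clifford relations: it is initial among the algebras equipped with n
   elements satisfying them.  This determines (A, g) up to a unique
   isomorphism. *)
Definition is_clifford (A : algType R[i]) (g : 'I_n -> A) : Prop :=
  clifford_relations g /\
  forall (B : algType R[i]) (h : 'I_n -> B), clifford_relations h ->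
    exists phi : {lrmorphism A -> B},
      (forall i, phi (g i) = h i) /\
      (forall psi : {lrmorphism A -> B},
         (forall i, psi (g i) = h i) -> psi =1 phi).

Variables (A : algType R[i]) (g : 'I_n -> A).

(* The product is taken in increasing order of the indices. *)
Definition gamma (I : {set 'I_n}) : A := \prod_(i <- enum I) g i.

(* Coordinates in the basis (gamma I)_I; when [is_clifford g] holds the family
   [gamma] is a basis, so [c] below exists and is unique, and the default
   value of [xget] is never used. *)
Definition gcoord (x : A) : {ffun {set 'I_n} -> R[i]} :=
  classical_sets.xget [ffun=> 0]
    (fun c => x = \sum_(I : {set 'I_n}) c I *: gamma I).

(* The homogeneous elements of degree d in Z/2, Z/2 being encoded by bool. *)
Definition homogeneous (d : bool) (x : A) : Prop :=
  exists c : {set 'I_n} -> R[i],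
    x = \sum_(I : {set 'I_n} | odd #|I| == d) c I *: gamma I.

Definition component (d : bool) (x : A) : A :=
  \sum_(I : {set 'I_n} | odd #|I| == d) gcoord x I *: gamma I.

(* The bilinear extension of x y - (-1)^(|x||y|) y x from homogeneous
   elements to A. *)
Definition gcomm (x y : A) : A :=
  \sum_(a : bool) \sum_(b : bool)
    (component a x * component b y
     - (-1) ^+ (a * b)%N *: (component b y * component a x)).

Definition graded_skew (br : A -> A -> A -> A) : Prop :=
  forall (d1 d2 d3 : bool) (x1 x2 x3 : A),
    homogeneous d1 x1 -> homogeneous d2 x2 -> homogeneous d3 x3 ->
    br x1 x2 x3 = - ((-1) ^+ (d1 * d2)%N *: br x2 x1 x3) /\
    br x1 x2 x3 = - ((-1) ^+ (d2 * d3)%N *: br x1 x3 x2).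

End Clifford.

Section ThreeBracket.
Variables (R : realType) (m : nat) (A : algType R[i]) (g : 'I_(2 * m) -> A).

(* The linear map sending gamma setT to (2i)^m and every other gamma I to 0. *)
Definition Str (x : A) : R[i] :=
  \sum_(I : {set 'I_(2 * m)})
    gcoord g x I * (if I == setT then (2%:R * 'i) ^+ m else 0).

Definition bracket3_basis (I J K : {set 'I_(2 * m)}) : A :=
  Str (gamma g I) *: gcomm g (gamma g J) (gamma g K)
  - (-1) ^+ (#|I| * #|J|)%N *:
      (Str (gamma g J) *: gcomm g (gamma g I) (gamma g K))
  + (-1) ^+ (#|K| * (#|I| + #|J|))%N *:
      (Str (gamma g K) *: gcomm g (gamma g I) (gamma g J)).

(* The trilinear extension of [bracket3_basis]. *)
Definition bracket3 (x y z : A) : A :=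
  \sum_(I : {set 'I_(2 * m)}) \sum_(J : {set 'I_(2 * m)})
    \sum_(K : {set 'I_(2 * m)})
      (gcoord g x I * gcoord g y J * gcoord g z K) *: bracket3_basis I J K.

End ThreeBracket.

(* Main.v *)
Require Import Defs.
From HB Require Import structures.
From mathcomp Require Import all_boot all_order all_algebra.
From mathcomp Require Import reals.
From mathcomp Require Import complex.
From mathcomp Require Import ring.

(** Moving a generator through an ordered monomial past the larger generators
    turns the product of two basis monomials into another one with sign:
    gamma I * gamma J = (-1)^(sigma I J) gamma (I Delta J) ([gammaM]).  Exchanging
    the factors changes the sign by (-1)^(|I| |J| + |I cap J|) ([gammaC]), since
    sigma I J + sigma J I counts the pairs of I x J off the diagonal.  The two
    facts give [gamma_I, gamma_J] = f(I, J) gamma (I Delta J) ([gcomm_gamma]).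

    Coordinates, components, the supertrace and the ternary bracket are all
    defined through expansions in the monomials, so they can be evaluated only
    once the monomials are known to be linearly independent ([gamma_free]).
    This holds in every nonzero algebra satisfying the Clifford relations when
    n is even: conjugation by the generators acts on each monomial by a sign,
    and for even n these signs tell distinct monomials apart, so that averaging
    over the conjugations isolates any single coefficient of a linear relation.

    The bracket of three monomials is then its defining formula.  That formula
    is graded skew-symmetric because the graded commutator is, and skew-symmetry
    extends to homogeneous elements by linearity.  The full set N has even
    cardinality 2m, so gamma N is even.  If only K is N, one supertrace survives
    and leaves (2i)^m [gamma_I, gamma_J]; if none is N, every supertrace
    vanishes; if two arguments are N, skew-symmetry in an even argument makes
    the bracket equal to its own opposite.  The other positions of a single N
    follow by skew-symmetry. *)

Set Implicit Arguments.
Unset Strict Implicit.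
Unset Printing Implicit Defensive.

Import Order.TTheory GRing.Theory Num.Theory.
Local Open Scope ring_scope.

(** * Products of monomials *)

Section Products.
Variables (R : realType) (n : nat) (A : algType R[i]) (g : 'I_n -> A).
Hypothesis gP : clifford_relations g.
Implicit Types (I J K : {set 'I_n}) (i j : 'I_n).
Local Notation gamma := (gamma g).

Lemma g_sqr i : g i * g i = 1.
Proof.
have := gP i i; rewrite eqxx mulr1 -mulr2n scaler_nat => /eqP.
rewrite -subr_eq0 -mulrnBl -scaler_nat scaler_eq0 pnatr_eq0 /= subr_eq0.
by move/eqP.
Qed.

Lemma g_anticomm i j : i != j -> g i * g j = - (g j * g i).
Proof.
move=> /negPf nij; have := gP i j; rewrite nij mulr0 scale0r => /eqP.
by rewrite addr_eq0 => /eqP.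
Qed.

Lemma gammaE I : gamma I = \prod_(i | i \in I) g i.
Proof. by rewrite -big_filter [index_enum _]unlock. Qed.

Lemma gamma0 : gamma set0 = 1.
Proof. by rewrite gammaE big_set0. Qed.

Lemma in_symdiff I J i : (i \in symdiff I J) = (i \in I) (+) (i \in J).
Proof. by rewrite !inE; case: (i \in I); case: (i \in J). Qed.

Lemma symdiffC I J : symdiff I J = symdiff J I.
Proof. by apply/setP => i; rewrite !in_symdiff addbC. Qed.

Lemma prod_anticomm (s : seq 'I_n) (P : pred 'I_n) j : j \notin s ->
  (\prod_(i <- s | P i) g i) * g j
  = (-1) ^+ count P s *: (g j * \prod_(i <- s | P i) g i).
Proof.
elim: s => [|i s IH]; first by rewrite !big_nil mulr1 mul1r scale1r.
rewrite inE negb_or => /andP[ji /IH{}IH]; rewrite !big_cons /=.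
case: (P i) => //; rewrite -mulrA IH -scalerAr [g j * (_ * _)]mulrA (g_anticomm ji).
by rewrite add1n exprS mulN1r scaleNr mulNr scalerN opprK mulrA.
Qed.

Lemma ltn_ord_trans : transitive (fun i k : 'I_n => (i < k)%N).
Proof. by move=> a b c; apply: ltn_trans. Qed.

Lemma index_enum_pairwise :
  pairwise (fun i k : 'I_n => (i < k)%N) (index_enum 'I_n).
Proof.
rewrite -(sorted_pairwise ltn_ord_trans).
have := iota_ltn_sorted 0 n; rewrite -val_enum_ord sorted_map enumT.
by rewrite [index_enum _]unlock.
Qed.

(** The product defining a monomial is ordered, so inserting or deleting the
    factor of index j requires cutting the enumeration exactly at j. *)
Lemma index_enum_split j : exists s1 s2 : seq 'I_n,
  [/\ index_enum 'I_n = s1 ++ j :: s2,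
      {in s1, forall i, (i < j)%N} & {in s2, forall i, (j < i)%N}].
Proof.
move: index_enum_pairwise; case/splitPr: (mem_index_enum j) => s1 s2.
rewrite pairwise_cat /= => /and3P[/allrelP h1 _ /andP[/allP h2 _]].
exists s1, s2; split=> // i si.
by apply: h1; rewrite ?inE ?eqxx.
Qed.

(** The new factor anticommutes past the factors of index larger than j,
    sigma1 I j in number; then it either squares to 1 with the factor of
    index j already there or takes its place. *)
Lemma gamma_mulg I j :
  gamma I * g j = (-1) ^+ sigma1 I j *: gamma (symdiff I [set j]).
Proof.
have [s1 [s2 [es lt1 lt2]]] := index_enum_split j.
have j2 : j \notin s2 by apply/negP => /lt2; rewrite ltnn.
(* The factors away from j are the same for I and for I Delta {j}. *)
have same (s : seq 'I_n) : {in s, forall i, i != j} ->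
    \prod_(i <- s | i \in symdiff I [set j]) g i = \prod_(i <- s | i \in I) g i.
  move=> sj; rewrite big_seq_cond [RHS]big_seq_cond; apply: eq_bigl => i.
  case si: (i \in s) => //=.
  by rewrite in_symdiff inE (negPf (sj i si)) addbF.
(* The members of I larger than j are those met in the tail of the cut. *)
have -> : sigma1 I j = count (mem I) s2.
  rewrite /sigma1 -sum1_card (eq_bigl (fun i => (i \in I) && (j < i)%N)).
    rewrite es big_cat big_cons ltnn andbF /= big_seq_cond big1 => [|i]; last first.
      case/and3P=> /lt1 ij _ ji.
      by move: (ltn_trans ij ji); rewrite ltnn.
    rewrite add0n -sum1_count big_seq_cond [RHS]big_seq_cond.
    by apply: eq_bigl => i; case si: (i \in s2); rewrite //= lt2 ?andbT.
  by move=> i; rewrite !inE.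
rewrite !gammaE es !big_cat !big_cons /= !same; first last.
- by move=> i /lt1 ij; rewrite -(inj_eq val_inj) neq_ltn ij.
- by move=> i /lt2 ij; rewrite -(inj_eq val_inj) neq_ltn ij orbT.
rewrite in_symdiff !inE eqxx -mulrA.
case: (j \in I) => /=; rewrite ?prod_anticomm //.
  by rewrite -mulrA prod_anticomm // -scalerAr mulrA g_sqr mul1r scalerAr.
by rewrite -scalerAr.
Qed.

(** Multiply by the factors of J one at a time, in increasing order: the
    factors added so far are smaller than the next index j, so they do not
    change the number of indices that it has to cross, which stays sigma1 I j. *)
Lemma gammaM I J : gamma I * gamma J = (-1) ^+ sigma I J *: gamma (symdiff I J).
Proof.
have key (s : seq 'I_n) : pairwise (fun i k : 'I_n => (i < k)%N) s ->
    gamma I * \prod_(j <- s) g j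
    = (-1) ^+ (\sum_(j <- s) sigma1 I j) *: gamma (symdiff I [set j in s]).
  elim/last_ind: s => [|s j IH].
    rewrite !big_nil mulr1 scale1r => _; congr gamma.
    by apply/setP => i; rewrite in_symdiff !inE addbF.
  rewrite pairwise_rcons => /andP[/allP sj ps].
  have js : j \notin s by apply/negP => /sj; rewrite ltnn.
  rewrite !big_rcons /= mulrA IH // -scalerAl gamma_mulg scalerA -exprD.
  congr (_ ^+ (_ + _) *: gamma _).
    apply: eq_card => i; rewrite !inE; case ji: (j < i)%N; rewrite ?andbF //.
    suff /negPf-> : i \notin s by rewrite !andbT andbF orbF.
    by apply/negP => /sj; rewrite ltnNge (ltnW ji).
  apply/setP => i; rewrite !in_symdiff !inE mem_rcons inE -addbA.
  by congr (_ (+) _); have [->|] := eqVneq i j; rewrite ?(negPf js) ?addbF.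
have {1}-> : gamma J = \prod_(j <- enum J) g j by [].
rewrite key.
  by rewrite big_enum; congr (_ *: gamma (symdiff _ _)); apply/setP => i;
    rewrite inE mem_enum.
have := index_enum_pairwise; rewrite [index_enum _]unlock.
exact: pairwise_filter.
Qed.

(** A pair (i, j) of I x J is counted by the first term if j < i, by the
    second if i < j and by the third if i = j. *)
Lemma sigma_swap I J : (sigma I J + sigma J I + #|I :&: J| = #|I| * #|J|)%N.
Proof.
have sE (X Y : {set 'I_n}) :
    sigma X Y = (\sum_(j in Y) \sum_(i in X) (j < i))%N.
  apply: eq_bigr => j _; rewrite /sigma1 -sum1_card -big_mkcondr /=.
  by apply: eq_bigl => i; rewrite !inE.
have -> : #|I :&: J| = (\sum_(j in J) \sum_(i in I) (i == j))%N.
  rewrite setIC -sum1_card.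
  rewrite (eq_bigl (fun j => (j \in J) && (j \in I))) => [|j]; last by rewrite inE.
  rewrite big_mkcondr; apply: eq_bigr => j _; rewrite -big_mkcondr /=.
  case: ifP => jI.
    by rewrite (big_pred1 j) // => i /=; case: eqP => [->|]; rewrite ?jI ?andbF.
  by rewrite big1 // => i /andP[iI /eqP ij]; rewrite -ij iI in jI.
rewrite !sE [X in (_ + X + _)%N]exchange_big /= -!big_split /=.
rewrite (eq_bigr (fun=> #|I|)) => [|j _]; first by rewrite sum_nat_const mulnC.
rewrite -!big_split /= -sum1_card; apply: eq_bigr => i _.
by rewrite -(inj_eq val_inj); case: ltngtP.
Qed.

Lemma signr_mulK (B : pzRingType) k : (-1) ^+ k * (-1) ^+ k = 1 :> B.
Proof. by rewrite -expr2 sqrr_sign. Qed.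

Lemma gammaC I J :
  gamma J * gamma I = (-1) ^+ (#|I| * #|J| + #|I :&: J|)%N *: (gamma I * gamma J).
Proof.
rewrite !gammaM symdiffC scalerA -exprD -sigma_swap; congr (_ *: _).
rewrite -[LHS]signr_odd -[RHS]signr_odd !oddD.
by case: (odd _); case: (odd _); case: (odd _).
Qed.

(** A monomial squares to a sign, which is nonzero because A is. *)
Lemma gamma_neq0 I : gamma I != 0.
Proof.
apply/eqP => g0; have := gammaM I I; rewrite g0 mul0r => /esym/eqP.
have -> : symdiff I I = set0 by rewrite /symdiff setDv setU0.
by rewrite scaler_eq0 signr_eq0 gamma0 oner_eq0.
Qed.

Lemma gamma_set1 i : gamma [set i] = g i.
Proof. by rewrite gammaE big_set1. Qed.

(** The monomials are common eigenvectors of the conjugations by the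
    generators, which is what separates them below. *)
Lemma g_conj i I : g i * gamma I * g i = (-1) ^+ (#|I| + (i \in I))%N *: gamma I.
Proof.
rewrite -!gamma_set1 gammaC cards1 muln1 -scalerAl -mulrA.
rewrite !gamma_set1 g_sqr mulr1; congr ((-1) ^+ (_ + _) *: _).
have [iI|iI] := boolP (i \in I).
  by rewrite (setIidPr _) ?cards1 // sub1set.
by apply/eqP; rewrite cards_eq0 setI_eq0 disjoint_sym disjoints1.
Qed.

(** * Linear independence of the monomials *)

Hypothesis n_even : ~~ odd n.

(** Conjugation by the generator i has different signs on the two monomials as
    soon as the parity of |I Delta J| and the membership of i in I Delta J
    differ.  If |I Delta J| is odd, some i lies outside it, n being even; if it
    is even, some i lies inside it, I and J being distinct.  For odd n the claim
    fails for the empty and the full set, whose monomials are both central. *)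
Lemma gamma_separated I J : I != J ->
  exists i, odd (#|I| + (i \in I) + (#|J| + (i \in J))).
Proof.
move=> nIJ; set D := symdiff I J.
have D_odd : odd #|D| = odd #|I| (+) odd #|J|.
  rewrite -(cardsID J I) -[#|J|](cardsID I J) [J :&: I]setIC /D /symdiff.
  rewrite cardsU; have -> : (I :\: J) :&: (J :\: I) = set0.
    by apply/setP => i; rewrite !inE; case: (i \in I); case: (i \in J).
  by rewrite cards0 subn0 !oddD; do 3 case: (odd _).
suff [i Hi] : exists i, (i \in D) = ~~ odd #|D|.
  exists i; move: Hi; rewrite in_symdiff D_odd !oddD !oddb.
  by case: (i \in I); case: (i \in J); do 2 case: (odd _).
have [oD|eD] := boolP (odd #|D|).
  suff: ~: D != set0 by case/set0Pn=> i; rewrite inE => /negPf; exists i.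
  apply: contraNneq n_even => D0; rewrite -[n]card_ord -cardsT.
  by rewrite -(setCK D) D0 setC0 in oD.
suff: D != set0 by case/set0Pn=> i iD; exists i.
apply: contraNneq nIJ => D0; apply/eqP/setP => i.
by have := in_symdiff I J i; rewrite -/D D0 inE; do 2 case: (i \in _).
Qed.

(** Adding to a linear relation its conjugate by g_i, with the sign of gamma J,
    doubles the terms with the same sign as gamma J and cancels the others.
    After all i only gamma J is left, with coefficient 2^n c_J. *)
Lemma gamma_free (c : {set 'I_n} -> R[i]) :
  \sum_I c I *: gamma I = 0 -> forall J, c J = 0.
Proof.
move=> c0 J; pose e I i : R[i] := (-1) ^+ (#|I| + (i \in I))%N.
have filtered (s : seq 'I_n) :
    \sum_I (c I * \prod_(i <- s) (1 + e J i * e I i)) *: gamma I = 0.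
  elim: s => [|i s IH].
    by rewrite -[RHS]c0; apply: eq_bigr => I _; rewrite big_nil mulr1.
  pose x := \sum_I (c I * \prod_(i <- s) (1 + e J i * e I i)) *: gamma I.
  transitivity (x + e J i *: (g i * x * g i)); last first.
    by rewrite /x IH mulr0 mul0r scaler0 addr0.
  rewrite mulr_sumr mulr_suml scaler_sumr -big_split; apply: eq_bigr => I _ /=.
  rewrite -scalerAr -scalerAl g_conj big_cons !scalerA -scalerDl.
  by congr (_ *: _); rewrite /e; ring.
have := filtered (index_enum 'I_n).
rewrite (bigD1 J) //= [X in _ + X]big1 => [|I nIJ]; last first.
  rewrite eq_sym in nIJ; have [i oi] := gamma_separated nIJ.
  rewrite (bigD1 i) //= /e -exprD -signr_odd oi expr1 subrr.
  by rewrite mul0r mulr0 scale0r.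
rewrite addr0 => /eqP; rewrite scaler_eq0 (negPf (gamma_neq0 J)) orbF.
rewrite (eq_bigr (fun=> 2%:R)) => [|i _]; last by rewrite /e signr_mulK.
by rewrite prodr_const mulf_eq0 expf_eq0 pnatr_eq0 andbF orbF => /eqP.
Qed.

(** * Coordinates and the graded commutator *)

Lemma gcoord_sum (c : {set 'I_n} -> R[i]) I :
  gcoord g (\sum_I c I *: gamma I) I = c I.
Proof.
set x := \sum_I _.
have : x = \sum_J gcoord g x J *: gamma J.
  apply: (@classical_sets.xgetPex _ _ (fun d : {ffun _ -> _} =>
    x = \sum_J d J *: gamma J)); exists [ffun J => c J].
  by apply: eq_bigr => J _; rewrite ffunE.
move/esym/eqP; rewrite -subr_eq0 -sumrB.
under eq_bigr do rewrite -scalerBl.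
by move=> /eqP/gamma_free/(_ I)/eqP; rewrite subr_eq0 => /eqP.
Qed.

Lemma gcoord_gamma I J : gcoord g (gamma I) J = (J == I)%:R.
Proof.
rewrite -[RHS](gcoord_sum (fun J => (J == I)%:R)); congr (gcoord g _ _).
rewrite (bigD1 I) //= eqxx scale1r big1 ?addr0 // => K /negPf->.
by rewrite scale0r.
Qed.

Lemma gcoord_homogeneous d x I :
  homogeneous g d x -> gcoord g x I != 0 -> odd #|I| = d.
Proof.
case=> c; rewrite big_mkcond /=.
under eq_bigr => K _.
  have -> : (if odd #|K| == d then c K *: gamma K else 0)
            = (if odd #|K| == d then c K else 0) *: gamma K.
    by case: ifP; rewrite ?scale0r.
  over.
move=> ->; rewrite gcoord_sum.
by case: (eqVneq (odd #|I|) d) => // _; rewrite eqxx.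
Qed.

Lemma sum_gcoord_gamma (V : lmodType R[i]) I (F : {set 'I_n} -> V) :
  \sum_J gcoord g (gamma I) J *: F J = F I.
Proof.
rewrite (bigD1 I) //= gcoord_gamma eqxx scale1r big1 ?addr0 // => J /negPf nJI.
by rewrite gcoord_gamma nJI scale0r.
Qed.

Lemma component_gamma d I :
  component g d (gamma I) = if odd #|I| == d then gamma I else 0.
Proof.
rewrite -(sum_gcoord_gamma I (fun J => if odd #|J| == d then gamma J else 0)).
rewrite /component big_mkcond /=; apply: eq_bigr => J _.
by case: ifP; rewrite ?scaler0.
Qed.

Lemma signr_oddM a b : (-1) ^+ (odd a * odd b)%N = (-1) ^+ (a * b)%N :> R[i].
Proof. by rewrite -signr_odd -[RHS]signr_odd !oddM !oddb. Qed.

Lemma gcomm_gamma I J :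
  gcomm g (gamma I) (gamma J) = fsign R I J *: gamma (symdiff I J).
Proof.
rewrite /gcomm (bigD1 (odd #|I|)) //= (bigD1 (odd #|J|)) //=.
rewrite !component_gamma !eqxx.
rewrite big1 => [|b]; last first.
  by rewrite eq_sym => /negPf nb; rewrite !component_gamma nb mulr0 mul0r scaler0 subr0.
rewrite big1 => [|b]; last first.
  rewrite eq_sym => /negPf nb; rewrite big1 // => b' _.
  by rewrite !component_gamma nb mulr0 mul0r scaler0 subr0.
rewrite !addr0 signr_oddM (gammaC I J) gammaM !scalerA -scalerBl; congr (_ *: _).
by rewrite /fsign exprD mulrA signr_mulK mul1r mulrBr mulr1 mulrC.
Qed.

(** Graded skew-symmetry is checked on the formula of [gcomm_gamma]: by
    [sigma_swap] the signs of f(J, I) and f(I, J) differ by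
    (-1)^(|I| |J| + |I cap J|), and the factor 1 - (-1)^|I cap J| turns
    multiplication by (-1)^|I cap J| into a change of sign. *)
Lemma gcomm_gammaC I J :
  gcomm g (gamma J) (gamma I)
  = - ((-1) ^+ (#|I| * #|J|)%N *: gcomm g (gamma I) (gamma J)).
Proof.
rewrite !gcomm_gamma symdiffC scalerA -scaleNr; congr (_ *: _).
rewrite /fsign setIC; set k := #|_ :&: _|.
have -> : (-1) ^+ sigma J I
  = (-1) ^+ (#|I| * #|J|)%N * (-1) ^+ sigma I J * (-1) ^+ k :> R[i].
  rewrite -sigma_swap !exprD -/k.
  transitivity ((-1) ^+ sigma I J * (-1) ^+ sigma I J
                * ((-1) ^+ k * (-1) ^+ k) * (-1) ^+ sigma J I : R[i]).
    by rewrite !signr_mulK !mul1r.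
  by ring.
transitivity ((-1) ^+ (#|I| * #|J|) * (-1) ^+ sigma I J
   * ((-1) ^+ k - (-1) ^+ k * (-1) ^+ k) : R[i]); first by ring.
by rewrite signr_mulK; ring.
Qed.

End Products.

(** * The ternary bracket *)

Section Bracket.
Variables (R : realType) (m : nat) (A : algType R[i]) (g : 'I_(2 * m) -> A).
Hypothesis gP : clifford_relations g.
Implicit Types (I J K : {set 'I_(2 * m)}).
Local Notation gamma := (gamma g).

Let n_even : ~~ odd (2 * m).
Proof. by rewrite mul2n odd_double. Qed.

Lemma Str_gamma I :
  Str g (gamma I) = if I == setT then (2%:R * 'i) ^+ m else 0.
Proof.
exact: (sum_gcoord_gamma gP n_even (V := R[i]^o) I
  (fun I => if I == setT then (2%:R * 'i) ^+ m else 0)).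
Qed.

Lemma bracket3_gamma I J K :
  bracket3 g (gamma I) (gamma J) (gamma K) = bracket3_basis g I J K.
Proof.
rewrite -[RHS](sum_gcoord_gamma gP n_even I (fun I => bracket3_basis g I J K)).
apply: eq_bigr => I' _.
rewrite -(sum_gcoord_gamma gP n_even J (fun J => bracket3_basis g I' J K)).
rewrite scaler_sumr; apply: eq_bigr => J' _.
rewrite -(sum_gcoord_gamma gP n_even K (fun K => bracket3_basis g I' J' K)).
rewrite !scaler_sumr; apply: eq_bigr => K' _.
by rewrite !scalerA.
Qed.

(** The swap exchanges the first two terms of the bracket, up to the sign, and
    acts on the third through the skew-symmetry of the graded commutator. *)
Lemma bracket3_basis_swap12 I J K :
  bracket3_basis g I J K
  = - ((-1) ^+ (#|I| * #|J|)%N *: bracket3_basis g J I K).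
Proof.
rewrite /bracket3_basis (gcomm_gammaC gP n_even I J).
set s := (-1) ^+ (#|I| * #|J|)%N.
rewrite [(#|J| * #|I|)%N]mulnC [(#|J| + _)%N]addnC -/s.
have sK (v : A) : s *: (s *: v) = v by rewrite scalerA signr_mulK scale1r.
have sC k (v : A) : k *: (s *: v) = s *: (k *: v) by rewrite !scalerA mulrC.
rewrite !(scalerDr, scalerN) !sC !sK !opprD !opprK.
by rewrite [X in X + _ = _]addrC.
Qed.

(** Here the last two terms are exchanged, and the first one is governed by the
    graded commutator. *)
Lemma bracket3_basis_swap23 I J K :
  bracket3_basis g I J K
  = - ((-1) ^+ (#|J| * #|K|)%N *: bracket3_basis g I K J).
Proof.
rewrite /bracket3_basis (gcomm_gammaC gP n_even J K).
rewrite [(#|K| * (#|I| + _))%N]mulnDr [(#|J| * (#|I| + _))%N]mulnDr !exprD.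
rewrite [(#|K| * #|I|)%N]mulnC [(#|J| * #|I|)%N]mulnC [(#|K| * #|J|)%N]mulnC.
rewrite -!scalerA; set s := (-1) ^+ (#|J| * #|K|)%N.
have sK (v : A) : s *: (s *: v) = v by rewrite scalerA signr_mulK scale1r.
have sC k (v : A) : k *: (s *: v) = s *: (k *: v) by rewrite !scalerA mulrC.
rewrite !(scalerDr, scalerN) !sC !sK !opprD !opprK.
by rewrite addrAC.
Qed.

(** Expand in monomials: a coordinate of a homogeneous element is zero unless
    the monomial has its degree, so the sign taken with the degrees is the sign
    taken with the cardinalities in every nonzero term. *)
Lemma bracket3_skew : graded_skew g (bracket3 g).
Proof.
move=> d1 d2 d3 x y z hx hy hz.
have hom := gcoord_homogeneous gP n_even.
rewrite /bracket3; split; rewrite scaler_sumr -sumrN.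
  rewrite exchange_big /=; apply: eq_bigr => J _.
  rewrite scaler_sumr -sumrN; apply: eq_bigr => I _.
  rewrite scaler_sumr -sumrN; apply: eq_bigr => K _.
  have [->|/(hom _ _ _ hx) <-] := eqVneq (gcoord g x I) 0.
    by rewrite mulr0 !mul0r !scale0r scaler0 oppr0.
  have [->|/(hom _ _ _ hy) <-] := eqVneq (gcoord g y J) 0.
    by rewrite mulr0 !mul0r !scale0r scaler0 oppr0.
  rewrite bracket3_basis_swap12 signr_oddM scalerN !scalerA.
  by congr (- (_ *: _)); ring.
apply: eq_bigr => I _; rewrite scaler_sumr -sumrN exchange_big /=.
apply: eq_bigr => K _; rewrite scaler_sumr -sumrN; apply: eq_bigr => J _.
have [->|/(hom _ _ _ hy) <-] := eqVneq (gcoord g y J) 0.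
  by rewrite mulr0 !(mul0r, mulr0) !scale0r scaler0 oppr0.
have [->|/(hom _ _ _ hz) <-] := eqVneq (gcoord g z K) 0.
  by rewrite mulr0 !(mul0r, mulr0) !scale0r scaler0 oppr0.
rewrite bracket3_basis_swap23 signr_oddM scalerN !scalerA.
by congr (- (_ *: _)); ring.
Qed.

End Bracket.

Theorem proposition5 (R : realType) (m : nat) (hm : (1 <= m)%N)
    (A : algType R[i]) (g : 'I_(2 * m) -> A) (hA : is_clifford g) :
  graded_skew g (bracket3 g) /\
  forall I J K : {set 'I_(2 * m)},
    [/\ (I != setT -> J != setT -> K = setT ->
           bracket3 g (gamma g I) (gamma g J) (gamma g K)
           = ((2%:R * 'i) ^+ m * fsign R I J) *: gamma g (symdiff I J)),
        (((I == setT) + (J == setT) + (K == setT))%N != 1%N ->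
           bracket3 g (gamma g I) (gamma g J) (gamma g K) = 0),
        (I != setT -> J = setT -> K != setT ->
           bracket3 g (gamma g I) (gamma g J) (gamma g K)
           = - ((-1) ^+ (#|J| * #|K|)%N *:
                 (((2%:R * 'i) ^+ m * fsign R I K) *: gamma g (symdiff I K))))
      & (I = setT -> J != setT -> K != setT ->
           bracket3 g (gamma g I) (gamma g J) (gamma g K)
           = (-1) ^+ (#|I| * (#|J| + #|K|))%N *:
               (((2%:R * 'i) ^+ m * fsign R J K) *: gamma g (symdiff J K)))].

Proof.
have [gP _] := hA.
have n_even : ~~ odd (2 * m) by rewrite mul2n odd_double.
split; first exact: bracket3_skew.
(* Signs with an exponent divisible by |N| = 2m are trivial. *)
have NE k : (-1) ^+ (#|[set: 'I_(2 * m)]| * k)%N = 1 :> R[i].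
  by rewrite cardsT card_ord -mulnA exprM sqrrN !expr1n.
have one I J : I != setT -> J != setT ->
    bracket3_basis g I J setT
    = ((2%:R * 'i) ^+ m * fsign R I J) *: gamma g (symdiff I J).
  move=> /negPf nI /negPf nJ.
  rewrite /bracket3_basis !Str_gamma // nI nJ eqxx !scale0r scaler0 subrr add0r.
  by rewrite NE scale1r gcomm_gamma // scalerA.
(* gamma N is even, so exchanging the equal arguments changes only the sign. *)
have two K : bracket3_basis g setT setT K = 0.
  have /eqP := bracket3_basis_swap12 gP setT setT K.
  rewrite NE scale1r -addr_eq0 -mulr2n -scaler_nat scaler_eq0 pnatr_eq0.
  by move/eqP.
move=> I J K; rewrite !bracket3_gamma //; split.
- by move=> nI nJ ->; apply: one.
- have [->|nI] := eqVneq I setT; last first.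
    have [->|nJ] := eqVneq J setT; have [->|nK] := eqVneq K setT => // _.
      rewrite bracket3_basis_swap12 // bracket3_basis_swap23 // two.
      by rewrite scaler0 oppr0 scaler0 oppr0.
    rewrite /bracket3_basis !Str_gamma // (negPf nI) (negPf nJ) (negPf nK).
    by rewrite !(scale0r, scaler0) subr0 addr0.
  have [->|nJ] := eqVneq J setT; first by rewrite two.
  have [->|//] := eqVneq K setT => _.
  by rewrite bracket3_basis_swap23 // two scaler0 oppr0.
- move=> nI -> nK; rewrite bracket3_basis_swap23 //.
  by rewrite one.
- move=> -> nJ nK.
  by rewrite bracket3_basis_swap12 // bracket3_basis_swap23 // one // !NE
    !scale1r opprK.
Qed.
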